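(* Let $n\geq 2$, let $K_n$ be the complete graph on $n$ vertices, and let $X$ be any finite simplicial complex. Then $\mathrm{Hom}(K_n,G_{1,X})$ is homotopy equivalent to $\mathrm{Hom}(K_2,G_{1,X})$.
   Context: Graphs are undirected, and loops are allowed: a graph is $G=(V(G),E(G))$ with $E(G)\subseteq V(G)\times V(G)$ symmetric. The complete graph $K_n$ has vertex set $\{1,\dots,n\}$ and edges $(i,j)$ for all $i\neq j$ (no loops). For a finite (abstract) simplicial complex $X$, $G_{1,X}$ is the reflexive graph obtained from the $1$-skeleton of the first barycentric subdivision of $X$ by adding a loop at each vertex. Explicitly, $V(G_{1,X})$ is the set of all nonempty simplices of $X$, and $(\sigma,\tau)\in E(G_{1,X})$ if and only if $\sigma\subseteq\tau$ or $\tau\subseteq\sigma$ (in particular $(\sigma,\sigma)\in E(G_{1,X})$ for every $\sigma$). For graphs $G$ and $H$, $\mathrm{Hom}(G,H)$ is the poset whose elements are all functions $\eta:V(G)\to 2^{V(H)}\setminus\{\emptyset\}$ such that $(u,v)\in E(G)$ implies $\eta(u)\times\eta(v)\subseteq E(H)$, ordered by $\eta\leq\eta'$ if and only if $\eta(u)\subseteq\eta'(u)$ for all $u\in V(G)$. As a topological space, $\mathrm{Hom}(G,H)$ means the geometric realization of the order complex (the simplicial complex of finite chains) of this poset; homotopy equivalence refers to these spaces. *)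

(* Defs.v *)
From HB Require Import structures.
From mathcomp Require Import all_boot all_order all_algebra.
Import Order.TTheory GRing.Theory Num.Theory.

Set Implicit Arguments.
Unset Strict Implicit.
Unset Printing Implicit Defensive.

(* Loops are allowed: [edge] need not be irreflexive. *)
Record graph := Graph {
  vert :> finType;
  edge : rel vert;
  edge_sym : symmetric edge
}.

Lemma neq_rel_sym (T : eqType) : symmetric (fun i j : T => i != j).
Proof. by move=> i j; rewrite eq_sym. Qed.

Definition complete_graph (n : nat) : graph :=
  Graph (@neq_rel_sym 'I_n).

(* Whether the empty simplex belongs to the family, and whether every point of
   [V] is a vertex, is left open: only nonempty simplices are ever used. *)
Record simplicial_complex (V : finType) := SimplicialComplex {
  simplices :> {set {set V}};
  simplices_closed : forall s t : {set V},
    t \subset s -> s \in simplices -> t \in simplices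
}.

Definition nonempty_simplex (V : finType) (X : simplicial_complex V) : finType :=
  {s : {set V} | (s \in simplices X) && (s != set0)}.

Definition comparable_simplices (V : finType) (X : simplicial_complex V) :
    rel (nonempty_simplex X) :=
  fun s t => (val s \subset val t) || (val t \subset val s).

Lemma comparable_simplices_sym (V : finType) (X : simplicial_complex V) :
  symmetric (@comparable_simplices V X).
Proof. by move=> s t; rewrite /comparable_simplices orbC. Qed.

(* $G_{1,X}$ *)
Definition subdivision_graph (V : finType) (X : simplicial_complex V) : graph :=
  Graph (@comparable_simplices_sym V X).

Definition is_multihom (G H : graph) (eta : {ffun G -> {set H}}) : bool :=
  [forall u, eta u != set0] &&
  [forall u, forall v, edge u v ==>
     (setX (eta u) (eta v) \subset [set p | edge p.1 p.2])].

Record multihom (G H : graph) := Multihom {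
  multihom_fun :> {ffun G -> {set H}};
  multihomP : is_multihom multihom_fun
}.

HB.instance Definition _ (G H : graph) :=
  [isSub of multihom G H for @multihom_fun G H].
HB.instance Definition _ (G H : graph) := [Finite of multihom G H by <:].

Definition multihom_le (G H : graph) : rel (multihom G H) :=
  fun eta eta' => [forall u, eta u \subset eta' u].

Lemma multihom_le_refl (G H : graph) : reflexive (@multihom_le G H).
Proof. by move=> eta; apply/forallP => u. Qed.

Lemma multihom_le_anti (G H : graph) : antisymmetric (@multihom_le G H).
Proof.
move=> eta eta' /andP[/forallP le1 /forallP le2].
by apply/val_inj/ffunP => u; apply/eqP; rewrite eqEsubset le1 le2.
Qed.

Lemma multihom_le_trans (G H : graph) : transitive (@multihom_le G H).
Proof.
move=> b a c /forallP le1 /forallP le2; apply/forallP => u.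
exact: subset_trans (le1 u) (le2 u).
Qed.

Fact multihom_display : Order.disp_t. Proof. exact: Order.Disp tt tt. Qed.

HB.instance Definition _ (G H : graph) :=
  Order.Le_isPOrder.Build multihom_display (multihom G H)
    (@multihom_le_refl G H) (@multihom_le_anti G H) (@multihom_le_trans G H).

Definition is_chain (d : Order.disp_t) (P : finPOrderType d) (C : {set P}) :
    bool :=
  [forall x in C, forall y in C, (x <= y)%O || (y <= x)%O].

Lemma is_chain_sub (d : Order.disp_t) (P : finPOrderType d) (s t : {set P}) :
  t \subset s -> s \in [set C | is_chain C] -> t \in [set C | is_chain C].
Proof.
move=> /subsetP ts; rewrite !inE => /forall_inP sP.
apply/forall_inP => x /ts /sP /forall_inP xP.
by apply/forall_inP => y /ts /xP.
Qed.

Definition order_complex (d : Order.disp_t) (P : finPOrderType d) :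
    simplicial_complex P :=
  SimplicialComplex (@is_chain_sub d P).

(* Required only here because the classical sets shadow [set0], [setX], etc. *)
From mathcomp Require Import all_classical all_reals all_analysis.
Import numFieldNormedType.Exports.

Local Open Scope classical_set_scope.
Local Open Scope ring_scope.

(* Points in barycentric coordinates. As [V] is finite, the topology induced
   from the product $\mathbb R^V$ is the usual one on $|X|$. *)
Definition realization (R : realType) (V : finType) (X : simplicial_complex V) :
    set (prod_topology (fun _ : V => R)) :=
  [set x | [/\ forall v, 0 <= x v, \sum_v x v = 1 &
               finset (fun v => x v != 0) \in simplices X]].
Arguments realization R {V} X.

(* The underlying set coerces to a type carrying the subset topology. *)
Definition hom_space (R : realType) (G H : graph) : topologicalType :=
  realization R (order_complex (multihom G H)).

Definition homotopic (R : realType) (A B : topologicalType) (f g : A -> B) :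
    Prop :=
  exists h : A * R -> B,
    [/\ {within [set: A] `*` `[0, 1], continuous h},
        forall a, h (a, 0) = f a & forall a, h (a, 1) = g a].

Definition homotopy_equivalent (R : realType) (A B : topologicalType) : Prop :=
  exists (f : A -> B) (g : B -> A),
    [/\ continuous f, continuous g,
        homotopic R (g \o f) id & homotopic R (f \o g) id].

(* Main.v *)
(* Write $A^\perp$ for the set of vertices adjacent to all of $A$ and
   $N(A) = A^\perp \cap A^{\perp\perp}$. In $H = G_{1,X}$, unions of bounded
   families and nonempty intersections of simplices are available, so $N(A)$ is
   nonempty as soon as $A$ and $A^\perp$ are. For a chain $s$ of multihomomorphisms
   $K_n \to H$ with $n \ge 2$, the set
   $U(s) = (\bigcup_{\eta \in s, i} N(\eta(i)))^{\perp\perp}$ is then a nonempty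
   looped clique, increasing in $s$, and
     $\bigcup_s \eta(i) \subseteq \bigcup_s (\eta(i) \cup N(\eta(i)))
      \supseteq \bigcup_s N(\eta(i)) \subseteq U(s)$.
   Since a clique gives a constant multihomomorphism $K_m \to H$ for every $m$,
   $U$ induces maps between the spaces of $\mathrm{Hom}(K_n, H)$ and
   $\mathrm{Hom}(K_m, H)$. Up to homotopy they are mutually inverse: one compares
   the composite with the identity along the inclusions above, each time by a
   straight-line homotopy. *)
Require Import Defs.
From mathcomp Require Import all_boot all_order all_algebra.
Import Order.TTheory.

Set Implicit Arguments.
Unset Strict Implicit.
Unset Printing Implicit Defensive.

(** * Commutants and chains of multihomomorphisms *)

Section Commutant.
Context {H : graph}.
Implicit Types (A B : {set H}).

(** This is $A^\perp$. As [edge] is symmetric, it forms an antitone Galois connection with itself;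
    [A \subset commutant A] means that [A] is a clique of looped vertices. *)
Definition commutant A : {set H} := [set v | [forall u in A, edge u v]].

Definition self_commutant A : {set H} :=
  commutant A :&: commutant (commutant A).

Lemma commutantP A v : reflect {in A, forall u, edge u v} (v \in commutant A).
Proof. by rewrite inE; apply: forall_inP. Qed.

Lemma commutantS A B : A \subset B -> commutant B \subset commutant A.
Proof.
move=> /subsetP AB; apply/subsetP => v /commutantP Bv.
by apply/commutantP => u /AB /Bv.
Qed.

Lemma sub_commutantC A B : A \subset commutant B -> B \subset commutant A.
Proof.
move=> /subsetP AB; apply/subsetP => v Bv; apply/commutantP => u /AB.
by move=> /commutantP /(_ v Bv); rewrite edge_sym.
Qed.

Lemma sub_bicommutant A : A \subset commutant (commutant A).
Proof. exact: sub_commutantC. Qed.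

Lemma bicommutantS A B : A \subset B ->
  commutant (commutant A) \subset commutant (commutant B).
Proof. by move=> AB; do 2!apply: commutantS. Qed.

Lemma bicommutantK A : commutant (commutant (commutant A)) = commutant A.
Proof.
apply/eqP; rewrite eqEsubset sub_bicommutant andbT.
exact/commutantS/sub_bicommutant.
Qed.

Lemma bicommutant_sub_commutant A :
  A \subset commutant A -> commutant (commutant A) \subset commutant A.
Proof. by move=> /bicommutantS; rewrite bicommutantK. Qed.

Lemma self_commutant_clique A :
  A \subset commutant A -> self_commutant A = commutant (commutant A).
Proof. by move=> /bicommutant_sub_commutant/setIidPr. Qed.

End Commutant.

(** This is what is retained of $G_{1,X}$: the equivalence is proved for every centered graph that
    admits multihomomorphisms from both complete graphs. *)
Definition centered_graph (H : graph) : Prop :=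
  forall A : {set H}, A != set0 -> commutant A != set0 -> self_commutant A != set0.

(* For [b] comparable with all of [A], the union of the members of [A] below
   [b], or the intersection of [A] if there are none, lies in the
   self-commutant of [A]. *)
Lemma subdivision_graph_centered (V : finType) (X : simplicial_complex V) :
  centered_graph (subdivision_graph X).
Proof.
move=> A /set0Pn[a aA] /set0Pn[b /commutantP bA].
have le_edge (s t : subdivision_graph X) : val s \subset val t -> edge s t.
  by move=> st; apply/orP; left.
have ge_edge (s t : subdivision_graph X) : val s \subset val t -> edge t s.
  by move=> st; apply/orP; right.
have edgeP (s t : subdivision_graph X) : edge s t ->
  (val s \subset val t) \/ (val t \subset val s) by move/orP.
have [/existsP[c /andP[cA cb]] | noc] :=
    boolP [exists c, (c \in A) && (val c \subset val b)].
  pose j := \bigcup_(s in A | val s \subset val b) val s.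
  have jb : j \subset val b by apply/bigcupsP => s /andP[].
  have jP : (j \in simplices X) && (j != set0).
    have /andP[bX _] := valP b.
    rewrite (simplices_closed jb bX) /=.
    have /andP[_ /set0Pn[v vc]] := valP c.
    by apply/set0Pn; exists v; apply/bigcupP; exists c => //; rewrite cA.
  pose x : subdivision_graph X := Sub j jP.
  have vx : val x = j by rewrite SubK.
  apply/set0Pn; exists x; rewrite inE; apply/andP; split.
    apply/commutantP => s sA; case: (edgeP _ _ (bA s sA)) => sb.
      by apply: le_edge; rewrite vx; apply: bigcup_sup; rewrite ?sA.
    by apply: ge_edge; rewrite vx; apply: subset_trans sb.
  apply/commutantP => d /commutantP dA.
  (* If [d] lies inside one of the simplices united in [j], it lies inside [j]; otherwise it
     contains each of them, hence [j]. *)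
  have [/existsP[s /andP[/andP[sA sb] ds]] | nos] :=
      boolP [exists s, (s \in A) && (val s \subset val b) && (val d \subset val s)].
    apply: le_edge; rewrite vx; apply: subset_trans ds _.
    by apply: bigcup_sup; rewrite ?sA.
  apply: ge_edge; rewrite vx; apply/bigcupsP => s /andP[sA sb].
  case: (edgeP _ _ (dA s sA)) => // ds.
  by case/existsP: nos; exists s; rewrite sA sb.
(* No member of [A] lies inside [b], so all contain [b], and their intersection inherits a point of
   [b]. *)
have Ab s : s \in A -> val b \subset val s.
  move=> sA; case: (edgeP _ _ (bA s sA)) => // sb.
  by case/existsP: noc; exists s; rewrite sA.
pose m := \bigcap_(s in A) val s.
have ma s : s \in A -> m \subset val s by move=> sA; apply: bigcap_inf.
have mP : (m \in simplices X) && (m != set0).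
  have /andP[aX _] := valP a.
  rewrite (simplices_closed (ma a aA) aX) /=.
  have /andP[_ /set0Pn[v vb]] := valP b.
  apply/set0Pn; exists v; apply/bigcapP => s sA.
  exact: (subsetP (Ab s sA)).
pose x : subdivision_graph X := Sub m mP.
have vx : val x = m by rewrite SubK.
apply/set0Pn; exists x; rewrite inE; apply/andP; split.
  by apply/commutantP => s sA; apply: ge_edge; rewrite vx ma.
apply/commutantP => d /commutantP dA.
have [/existsP[s /andP[sA sd]] | nos] :=
    boolP [exists s, (s \in A) && (val s \subset val d)].
  by apply: ge_edge; rewrite vx; apply: subset_trans sd; apply: ma.
apply: le_edge; rewrite vx; apply/bigcapsP => s sA.
case: (edgeP _ _ (dA s sA)) => // ds.
by case/existsP: nos; exists s; rewrite sA.
Qed.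

(** * Chains of multihomomorphisms from a complete graph *)

Section MultihomFamilies.
Context {H : graph} {n : nat}.
Local Notation hom := (multihom (complete_graph n) H).
Implicit Types (eta : hom) (s : {set hom}) (i j : 'I_n).

Lemma multihom_neq0 (eta : hom) (i : 'I_n) : eta i != set0.
Proof. by have /andP[/forallP/(_ i) eta0 _] := multihomP eta. Qed.

Lemma multihom_edge (eta : hom) (i j : 'I_n) u v :
  i != j -> u \in eta i -> v \in eta j -> edge u v.
Proof.
move=> ij ui vj; have /andP[_ /forallP/(_ i)/forallP/(_ j)/implyP] := multihomP eta.
move=> /(_ ij)/subsetP/(_ (u, v)); rewrite !inE /=; apply.
by rewrite ui vj.
Qed.

Lemma is_multihomP (f : {ffun complete_graph n -> {set H}}) :
  (forall i : 'I_n, f i != set0) ->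
  (forall (i j : 'I_n) u v, i != j -> u \in f i -> v \in f j -> edge u v) ->
  is_multihom f.
Proof.
move=> f0 fE; apply/andP; split; first by apply/forallP => i; apply: f0.
apply/forallP => i; apply/forallP => j; apply/implyP => ij.
by apply/subsetP => -[u v]; rewrite !inE /= => /andP[]; apply: fE.
Qed.

(** From $\eta(j)\subseteq\eta(i)^\perp$ one gets
    $\eta(j)^{\perp\perp}\subseteq\eta(i)^{\perp\perp\perp}=\eta(i)^\perp$. Hence values may be
    enlarged within their double commutants. *)
Lemma bicommutant_edge (eta : hom) (i j : 'I_n) u v : i != j ->
  u \in commutant (commutant (eta i)) -> v \in commutant (commutant (eta j)) ->
  edge u v.
Proof.
move=> ij; have ji : eta j \subset commutant (eta i).
  apply/subsetP => w wj; apply/commutantP => x xi; exact: (multihom_edge ij xi wj).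
have := bicommutantS ji; rewrite bicommutantK => /subsetP ji2 ui /ji2 vj.
by have /commutantP/(_ v vj) := ui; rewrite edge_sym.
Qed.

Lemma chain_le s eta eta' : is_chain s -> eta \in s -> eta' \in s ->
  exists2 theta, theta \in s & (eta <= theta)%O && (eta' <= theta)%O.
Proof.
move=> /forall_inP cs es es'; have /forall_inP/(_ _ es') := cs _ es.
by case/orP => le; [exists eta' | exists eta]; rewrite ?le ?lexx.
Qed.

Lemma multihom_le_sub (eta eta' : hom) (i : 'I_n) :
  (eta <= eta')%O -> eta i \subset eta' i.
Proof. by move/forallP/(_ i). Qed.

Lemma chain_bicommutant_edge s eta eta' i j u v :
  is_chain s -> eta \in s -> eta' \in s -> i != j ->
  u \in commutant (commutant (eta i)) -> v \in commutant (commutant (eta' j)) ->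
  edge u v.
Proof.
move=> cs es es' ij ui vj; have [t _ /andP[le le']] := chain_le cs es es'.
apply: (bicommutant_edge (eta := t) ij).
  exact: (subsetP (bicommutantS (multihom_le_sub _ le))).
exact: (subsetP (bicommutantS (multihom_le_sub _ le'))).
Qed.

(** The new case is $i=j$: if $\eta\le\eta'$, then
    $u\in\eta(i)^{\perp\perp}\subseteq\eta'(i)^{\perp\perp}$ while $v\in\eta'(i)^\perp$. So all the
    self-commutants along a chain together form a looped clique. *)
Lemma chain_self_commutant_edge s eta eta' i j u v :
  is_chain s -> eta \in s -> eta' \in s ->
  u \in self_commutant (eta i) -> v \in self_commutant (eta' j) ->
  edge u v.
Proof.
move=> cs es es'; have [<-|ij] := eqVneq i j; last first.
  rewrite !inE => /andP[_ ui] /andP[_ vj].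
  by apply: (chain_bicommutant_edge cs es es' ij); rewrite inE.
move=> /setIP[ui ui2] /setIP[vi vi2].
have /forall_inP/(_ _ es) /forall_inP/(_ _ es') := cs.
case/orP => /(multihom_le_sub i) le.
  have /commutantP := subsetP (bicommutantS le) _ ui2.
  by move=> /(_ v vi); rewrite edge_sym.
have /commutantP := subsetP (bicommutantS le) _ vi2.
by move=> /(_ u ui).
Qed.

End MultihomFamilies.

Section HomUnion.
Context {H : graph} {n : nat} (eta0 : multihom (complete_graph n) H).
Local Notation hom := (multihom (complete_graph n) H).
Implicit Types (eta : hom) (s : {set hom}) (f : hom -> 'I_n -> {set H}).

(* [eta0] is a junk value, taken when the unions do not define a
   multihomomorphism; they do whenever [s] is a nonempty chain and each
   [f eta i] is a nonempty subset of the double commutant of [eta i]. *)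
Definition hom_union f s : hom :=
  insubd eta0 [ffun i => \bigcup_(eta in s) f eta i].

Lemma hom_unionE f s i : is_chain s -> s != set0 ->
  (forall eta j, f eta j != set0) ->
  (forall eta j, f eta j \subset commutant (commutant (eta j))) ->
  hom_union f s i = \bigcup_(eta in s) f eta i.
Proof.
move=> cs /set0Pn[eta es] f0 fCC; rewrite /hom_union [in LHS]/insubd insubT /=.
  apply: is_multihomP => [j|j k u v jk]; rewrite !ffunE.
    have /set0Pn[u fu] := f0 eta j; apply/set0Pn; exists u.
    by apply/bigcupP; exists eta.
  move=> /bigcupP[e1 e1s /(subsetP (fCC _ _)) ue1].
  move=> /bigcupP[e2 e2s /(subsetP (fCC _ _)) ve2].
  exact: (chain_bicommutant_edge cs e1s e2s jk).
by move=> hf; rewrite ffunE.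
Qed.

Lemma hom_union_le f f' s s' : is_chain s' -> s != set0 -> s \subset s' ->
  (forall eta j, f eta j != set0) -> (forall eta j, f eta j \subset f' eta j) ->
  (forall eta j, f' eta j \subset commutant (commutant (eta j))) ->
  (hom_union f s <= hom_union f' s')%O.
Proof.
move=> cs' s0 ss' f0 ff' f'CC.
have cs : is_chain s.
  by have := is_chain_sub ss'; rewrite !inE; apply.
have s'0 : s' != set0 by apply: contraNneq s0 => s'0; rewrite -subset0 -s'0.
apply/forallP => i; rewrite !hom_unionE //.
- apply/bigcupsP => eta es; apply: subset_trans (ff' _ _) _.
  by apply: (bigcup_sup eta); rewrite ?(subsetP ss').
- move=> eta j; apply: contraNneq (f0 eta j) => f'0.
  by rewrite -subset0 -f'0.
- by move=> eta j; apply: subset_trans (ff' _ _) (f'CC _ _).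
Qed.

End HomUnion.

Section HomDiagonal.
Context {H : graph} {n : nat} (eta0 : multihom (complete_graph n) H).

Implicit Types (C D : {set H}).

(** Here too [eta0] is a junk value, never taken when [C] is a nonempty looped clique. *)
Definition hom_diagonal C : multihom (complete_graph n) H :=
  insubd eta0 [ffun=> C].

Lemma hom_diagonalE C i : C != set0 -> C \subset commutant C ->
  hom_diagonal C i = C.
Proof.
move=> C0 /subsetP cC; rewrite /hom_diagonal [in LHS]/insubd insubT /=.
  apply: is_multihomP => [j|j k u v _]; rewrite !ffunE // => uC vC.
  by have /commutantP := cC v vC; apply.
by move=> hC; rewrite ffunE.
Qed.

Lemma hom_diagonal_le C D : C != set0 -> C \subset D -> D \subset commutant D ->
  (hom_diagonal C <= hom_diagonal D)%O.
Proof.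
move=> C0 CD cD; have D0 : D != set0.
  by apply: contraNneq C0 => D0; rewrite -subset0 -D0.
have cC : C \subset commutant C.
  exact: subset_trans CD (subset_trans cD (commutantS CD)).
by apply/forallP => i; rewrite !hom_diagonalE.
Qed.

End HomDiagonal.

(** * The looped clique attached to a chain *)

Section Core.
Context {H : graph} {n : nat}.
Context (Hc : centered_graph H) (n_gt1 : 1 < n).
Local Notation hom := (multihom (complete_graph n) H).
Implicit Types (eta : hom) (s : {set hom}).

(** This is where $n\ge 2$ enters: for a second index $j$, the nonempty set $\eta(j)$ lies in
    $\eta(i)^\perp$, so centeredness applies. *)
Lemma self_commutant_neq0 eta i : self_commutant (eta i) != set0.
Proof.
apply: Hc; first exact: multihom_neq0.
have [j ji] : exists j, j != i.
  have n_gt0 := ltnW n_gt1.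
  have [i0|i0] := eqVneq i (Ordinal n_gt0).
    by exists (Ordinal n_gt1); rewrite i0.
  by exists (Ordinal n_gt0); rewrite eq_sym.
have /set0Pn[v vj] := multihom_neq0 eta j.
apply/set0Pn; exists v; apply/commutantP => u ui.
by apply: (multihom_edge _ ui vj); rewrite eq_sym.
Qed.

(** This is $U(s)$. The outer double commutant makes it closed, as [core_closed_cliques] requires of
    [C]. *)
Definition core s : {set H} :=
  commutant (commutant (\bigcup_(eta in s) \bigcup_i self_commutant (eta i))).

Lemma coreK s : commutant (commutant (core s)) = core s.
Proof. by rewrite /core bicommutantK. Qed.

Lemma self_commutant_sub_core s eta i :
  eta \in s -> self_commutant (eta i) \subset core s.
Proof.
move=> es; apply: subset_trans (sub_bicommutant _).
apply/subsetP => u ui; apply/bigcupP; exists eta => //.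
by apply/bigcupP; exists i.
Qed.

Lemma coreS s s' : s \subset s' -> core s \subset core s'.
Proof.
move=> /subsetP ss'; apply: bicommutantS; apply/bigcupsP => eta /ss' es.
exact: (bigcup_sup eta).
Qed.

Lemma core_neq0 s : s != set0 -> core s != set0.
Proof.
case/set0Pn => eta es; pose i := Ordinal n_gt1.
apply: contraNneq (self_commutant_neq0 eta i) => c0.
by rewrite -subset0 -c0 self_commutant_sub_core.
Qed.

Lemma core_clique s : is_chain s -> core s \subset commutant (core s).
Proof.
move=> cs; rewrite {2}/core bicommutantK; apply: bicommutant_sub_commutant.
apply/subsetP => u /bigcupP[e1 e1s /bigcupP[i _ ui]].
apply/commutantP => v /bigcupP[e2 e2s /bigcupP[j _ vj]].
exact: (chain_self_commutant_edge cs e2s e1s vj ui).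
Qed.

(** A closed clique [D] is its own self-commutant. So either some [D] contains [C], and then so does
    the core, or every [D] lies in the closed set [C], and then so does the core. It serves to
    compare a core of cores with a core. *)
Lemma core_closed_cliques s (C : {set H}) : commutant (commutant C) = C ->
  {in s, forall eta, exists D : {set H}, [/\ forall i, eta i = D,
     D \subset commutant D, commutant (commutant D) = D &
     (D \subset C) || (C \subset D)]} ->
  (core s \subset C) || (C \subset core s).
Proof.
move=> CK sD; have [/existsP[eta /andP[es /existsP[i Ceta]]]|noeta] :=
  boolP [exists eta, (eta \in s) && [exists i, C \subset eta i]].
  have [D [etaD cD DK _]] := sD _ es; apply/orP; right.
  rewrite etaD in Ceta; apply: subset_trans Ceta _.
  have := self_commutant_sub_core i es.
  by rewrite etaD self_commutant_clique // DK.
apply/orP; left; rewrite -CK; apply: bicommutantS.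
apply/bigcupsP => eta es; apply/bigcupsP => i _.
have [D [etaD cD DK]] := sD _ es; rewrite etaD self_commutant_clique // DK.
case/orP => // CD; case/existsP: noeta; exists eta; rewrite es.
by apply/existsP; exists i; rewrite etaD.
Qed.

End Core.

(* Required only here because the classical sets shadow [set0], [\bigcup], etc. *)
From mathcomp Require Import all_classical all_reals all_analysis.
From mathcomp Require Import lra.
Import GRing.Theory Num.Theory.
Import numFieldNormedType.Exports.

Local Open Scope classical_set_scope.
Local Open Scope ring_scope.

(** * Maps and homotopies into geometric realizations *)

Section Realization.
Context {R : realType} {V : finType} {L : simplicial_complex V}.
Local Notation coord x := (set_val x : V -> R).

Lemma coord_ge0 (x : realization R L) v : 0 <= coord x v.
Proof. by have /set_mem[+ _ _] := valP x; apply. Qed.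

Lemma coord_sum (x : realization R L) : \sum_v coord x v = 1.
Proof. by have /set_mem[] := valP x. Qed.

Lemma coord_support (x : realization R L) :
  finset (fun v => coord x v != 0) \in simplices L.
Proof. by have /set_mem[] := valP x. Qed.

Lemma barycentric_coord_continuous v : continuous (fun x : realization R L => coord x v).
Proof.
move=> x; apply: (@continuous_comp _ (prod_topology (fun _ : V => R)) _
  set_val (@proj V (fun=> R : topologicalType) v)).
  exact: initial_continuous.
exact: proj_continuous.
Qed.

Lemma coord_comp_continuous (T : topologicalType) (f : T -> realization R L) v :
  continuous f -> continuous (fun a => coord (f a) v).
Proof.
move=> fc a; apply: (@continuous_comp _ _ _ f (fun x => coord x v)).
  exact: fc.
exact: barycentric_coord_continuous.
Qed.

Definition to_realization (T : Type) (f : T -> V -> R)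
    (fP : forall a, realization R L (f a)) (a : T) : realization R L :=
  SigSub (mem_set (fP a)).

Lemma to_realization_continuous (T : topologicalType) (f : T -> V -> R)
    (fP : forall a, realization R L (f a)) :
  (forall v, continuous (fun a => f a v)) -> continuous (to_realization fP).
Proof.
move=> fc; apply: continuous_comp_initial => a.
apply/cvg_sup => v U /= [_ [[W oW <-] Wfa] /filterS]; apply.
by apply: fc; apply: open_nbhs_nbhs.
Qed.

Lemma realizationP_sub (x : V -> R) (s : {set V}) : s \in simplices L ->
  (forall v, 0 <= x v) -> \sum_v x v = 1 -> (forall v, x v != 0 -> v \in s) ->
  realization R L x.
Proof.
move=> sL x0 x1 xs; split=> //; apply: simplices_closed sL.
by apply/fintype.subsetP => v; rewrite inE => /xs.
Qed.

Lemma realization_eq (x y : realization R L) : coord x =1 coord y -> x = y.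
Proof. by move=> xy; apply/val_inj/funext. Qed.

End Realization.

(** * Concatenated and straight-line homotopies *)

Section Homotopy.
Context {R : realType}.
Local Notation coord x := (set_val x : _ -> R).

(** The retraction of the line onto $[0,1]$, by which homotopies extend to all times. *)
Definition clamp (t : R) : R := Num.max 0 (Num.min 1 t).

Lemma clamp_bounds t : 0 <= clamp t <= 1.
Proof. by rewrite /clamp le_max lexx ge_max ler01 ge_min lexx. Qed.

Lemma clamp_le0 t : t <= 0 -> clamp t = 0.
Proof. by rewrite /clamp => t0; apply/max_idPl; rewrite ge_min t0 orbT. Qed.

Lemma clamp_ge1 t : 1 <= t -> clamp t = 1.
Proof. by rewrite /clamp => /min_idPl ->; apply/max_idPr. Qed.

Lemma clamp_continuous : continuous clamp.
Proof.
move=> t; apply: (@continuous_max R R (cst 0) (fun t => Num.min 1 t)).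
  exact: cst_continuous.
apply: (@continuous_min R R (cst 1) id); first exact: cst_continuous.
exact: cvg_id.
Qed.

Lemma reparametrization_continuous (A B : topologicalType) (h : A * R -> B)
    (r : R -> R) :
  continuous h -> continuous r -> continuous (fun p => h (p.1, r p.2)).
Proof.
move=> hc rc p; apply: (@continuous_comp _ _ _ (fun p => (p.1, r p.2)) h).
  apply: (@cvg_pair _ _ _ _ (nbhs p.1) (nbhs (r p.2))); first exact: cvg_fst.
  apply: (@continuous_comp _ _ _ snd r); first exact: cvg_snd.
  exact: rc.
exact: hc.
Qed.

(* A homotopy defined for all times: such homotopies can be reparametrized
   without any boundary condition. *)
Definition homotopic_line (A B : topologicalType) (f g : A -> B) : Prop :=
  exists h : A * R -> B,
    [/\ continuous h, forall a, h (a, 0) = f a & forall a, h (a, 1) = g a].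

Lemma homotopic_lineW (A B : topologicalType) (f g : A -> B) :
  homotopic_line f g -> homotopic R f g.
Proof.
by case=> h [hc h0 h1]; exists h; split=> //; exact: continuous_subspaceT.
Qed.

Context {V : finType} {L : simplicial_complex V} {A : topologicalType}.
Implicit Types f g k : A -> realization R L.

Lemma homotopic_line_trans f g k :
  homotopic_line f g -> homotopic_line g k -> homotopic_line f k.
Proof.
case=> h1 [c1 h10 h11] [h2 [c2 h20 h21]].
have half (t : R) : 2 * t <= 1 -> clamp (2 * t - 1) = 0.
  by move=> t1; rewrite clamp_le0 // subr_le0.
have half' (t : R) : 1 <= 2 * t -> clamp (2 * t) = 1 by exact: clamp_ge1.
(* One global formula replaces gluing at time $1/2$: before it the second term is [g], after it the
   first is, and either cancels against the subtracted [g]. Continuity is then clear in coordinates,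
   and each half shows that the values lie in the realization. *)
pose h (p : A * R) (v : V) := coord (h1 (p.1, clamp (2 * p.2))) v
   + coord (h2 (p.1, clamp (2 * p.2 - 1))) v - coord (g p.1) v.
have hE1 (p : A * R) : 2 * p.2 <= 1 -> h p = coord (h1 (p.1, clamp (2 * p.2))).
  by move=> /half p1; apply/funext => v; rewrite /h p1 h20 addrK.
have hE2 (p : A * R) : 1 <= 2 * p.2 -> h p = coord (h2 (p.1, clamp (2 * p.2 - 1))).
  by move=> /half' p1; apply/funext => v; rewrite /h p1 h11 addrC addKr.
have hP p : realization R L (h p).
  by case: (leP (2 * p.2) 1) => [/hE1|/ltW/hE2] ->; apply/set_mem/valP.
exists (to_realization hP); split.
- apply: to_realization_continuous => v p.
  have mc : continuous (fun t : R => 2 * t) by exact: mulrl_continuous.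
  have cc : continuous (fun t : R => clamp (2 * t)).
    by move=> t; apply: continuous_comp; [exact: mc | exact: clamp_continuous].
  have cc' : continuous (fun t : R => clamp (2 * t - 1)).
    move=> t; apply: (@continuous_comp _ _ _ (fun t : R => 2 * t - 1) clamp).
      by apply: cvgB; [exact: mc | exact: cvg_cst].
    exact: clamp_continuous.
  apply: cvgB; first apply: cvgD.
  + exact: (coord_comp_continuous (reparametrization_continuous c1 cc)).
  + exact: (coord_comp_continuous (reparametrization_continuous c2 cc')).
  (* Continuity of [g] is read off from [h2] at time $0$. *)
  + have c0 : continuous (fun _ : R => 0 : R) by move=> t; exact: cvg_cst.
    have gE : (fun p : A * R => h2 (p.1, 0)) = g \o fst.
      by apply/funext => q; exact: h20.
    have := reparametrization_continuous c2 c0; rewrite gE => gc.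
    exact: (coord_comp_continuous gc).
- by move=> a; apply/realization_eq => v; rewrite set_valE /= hE1 ?mulr0 ?clamp_le0 ?h10.
- by move=> a; apply/realization_eq => v; rewrite set_valE /= hE2 ?mulr1 ?clamp_ge1 ?h21//; lra.
Qed.

(** The points $f(a)$ and $g(a)$ lie in a common simplex [s], so the segment joining them stays in
    the realization. *)
Lemma contiguous_homotopic_line f g : continuous f -> continuous g ->
  (forall a, exists2 s, s \in simplices L &
     forall v, coord (f a) v != 0 \/ coord (g a) v != 0 -> v \in s) ->
  homotopic_line f g.
Proof.
move=> fc gc fg.
pose h (p : A * R) (v : V) :=
  (1 - clamp p.2) * coord (f p.1) v + clamp p.2 * coord (g p.1) v.
have hP p : realization R L (h p).
  have [s sL sP] := fg p.1; have /andP[c0 c1] := clamp_bounds p.2.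
  apply: (realizationP_sub sL) => [v||v].
  - by rewrite addr_ge0 // mulr_ge0 ?coord_ge0 // subr_ge0.
  - rewrite big_split/= -!mulr_sumr !coord_sum; lra.
  - move=> hv; apply: sP; apply/orP; apply: contraNT hv.
    by rewrite negb_or !negbK /h => /andP[/eqP-> /eqP->]; rewrite !mulr0 addr0.
exists (to_realization hP); split.
- apply: to_realization_continuous => v p; rewrite /h.
  have cc : {for p, continuous (fun p : A * R => clamp p.2)}.
    by apply: continuous_comp; [exact: cvg_snd | exact: clamp_continuous].
  have coord1 (k : A -> realization R L) : continuous k ->
      {for p, continuous (fun p : A * R => coord (k p.1) v)}.
    move=> kc; apply: (@continuous_comp _ _ _ fst (fun a => coord (k a) v)).
      exact: cvg_fst.
    exact: coord_comp_continuous.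
  by apply: cvgD; apply: cvgM => //; [| exact: coord1 | exact: coord1];
    apply: cvgB => //; exact: cvg_cst.
- move=> a; apply/realization_eq => v; rewrite set_valE /= /h clamp_le0 //.
  by rewrite subr0 mul1r mul0r addr0.
- move=> a; apply/realization_eq => v; rewrite set_valE /= /h clamp_ge1 //.
  by rewrite subrr mul0r mul1r add0r.
Qed.

End Homotopy.
Arguments homotopic_line R {A B}.

(** * Weights supported on superlevel sets *)

Section ThresholdWeight.
Context {R : realType} {V : finType}.
Implicit Types (a b : R) (x : V -> R) (c : {set V}).

(* Nonzero only if [c] is a superlevel set of [x] for some level in [[a, b)];
   such sets are nested. *)
Definition threshold_weight a b x c : R :=
  \prod_(p in c) Num.max 0 (x p - a) *
  \prod_(q in ~: c) Num.max 0 (b - x q) *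
  \prod_(p in c) \prod_(q in ~: c) Num.max 0 (x p - x q).

Lemma max0_ge0 (t : R) : 0 <= Num.max 0 t.
Proof. by rewrite le_max lexx. Qed.

Lemma max0_neq0 (t : R) : (Num.max 0 t != 0) = (0 < t).
Proof. by case: (ltP 0 t) => t0; [rewrite gt_eqF | rewrite eqxx]. Qed.

Lemma threshold_weight_ge0 a b x c : 0 <= threshold_weight a b x c.
Proof.
rewrite !mulr_ge0 //; do ?[apply: prodr_ge0 => ? _]; exact: max0_ge0.
Qed.

Lemma threshold_weight_neq0P a b x c :
  reflect [/\ forall p, p \in c -> a < x p, forall q, q \notin c -> x q < b &
              forall p q, p \in c -> q \notin c -> x q < x p]
          (threshold_weight a b x c != 0).
Proof.
rewrite !mulf_eq0 !negb_or -andbA; apply: (iffP and3P).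
  case=> /prodf_neq0 c1 /prodf_neq0 c2 /prodf_neq0 c3; split.
  - by move=> p /c1; rewrite max0_neq0 subr_gt0.
  - by move=> q qc; have := c2 q; rewrite inE max0_neq0 subr_gt0; apply.
  - move=> p q /c3 /prodf_neq0 cp qc.
    by have := cp q; rewrite inE max0_neq0 subr_gt0; apply.
case=> c1 c2 c3; split; apply/prodf_neq0 => p.
- by move=> pc; rewrite max0_neq0 subr_gt0 c1.
- by rewrite inE => pc; rewrite max0_neq0 subr_gt0 c2.
- move=> pc; apply/prodf_neq0 => q; rewrite inE => qc.
  by rewrite max0_neq0 subr_gt0 c3.
Qed.

(** Points $p\in c\setminus c'$ and $q\in c'\setminus c$ would give both $x_q<x_p$ and $x_p<x_q$.
    The level intervals may differ, which allows different maps to be compared. *)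
Lemma threshold_weight_nested a b a' b' x c c' :
  threshold_weight a b x c != 0 -> threshold_weight a' b' x c' != 0 ->
  (c \subset c') || (c' \subset c).
Proof.
move=> /threshold_weight_neq0P[_ _ c3] /threshold_weight_neq0P[_ _ c'3].
apply: contraT; rewrite negb_or => /andP[/subsetPn[p pc pc'] /subsetPn[q qc' qc]].
by have := lt_trans (c3 p q pc qc) (c'3 q p qc' pc'); rewrite ltxx.
Qed.

Lemma threshold_weight_sum_gt0 a b x : a < b ->
  0 < \sum_c threshold_weight a b x c.
Proof.
(* The superlevel set at [a] always has positive weight: outside it the values are at most [a],
   hence below [b]. *)
move=> ab; pose c := finset (fun p => a < x p).
have wc : threshold_weight a b x c != 0.
  apply/threshold_weight_neq0P; split => [p|q|p q]; rewrite !inE //.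
    by rewrite -leNgt => /le_lt_trans; apply.
  by move=> ap; rewrite -leNgt => /le_lt_trans; apply.
rewrite (bigD1 c) //=; apply: ltr_pwDl.
  by rewrite lt_def wc threshold_weight_ge0.
by apply: sumr_ge0 => c' _; exact: threshold_weight_ge0.
Qed.

Lemma threshold_weight_continuous (T : topologicalType) a b (f : T -> V -> R) c :
  (forall v, continuous (fun t => f t v)) ->
  continuous (fun t => threshold_weight a b (f t) c).
Proof.
move=> fc.
have mc : continuous (fun z : R * R => z.1 * z.2) by exact: mul_continuous.
have max0c (g : T -> R) : continuous g -> continuous (fun t => Num.max 0 (g t)).
  move=> gc t; apply: (@continuous_max R T (cst 0) g); last exact: gc.
  exact: cst_continuous.
move=> t; apply: cvgM; first apply: cvgM.
- apply: (continuous_big mc) => p _; apply: max0c => u.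
  by apply: cvgB; [exact: fc | exact: cvg_cst].
- apply: (continuous_big mc) => p _; apply: max0c => u.
  by apply: cvgB; [exact: cvg_cst | exact: fc].
- apply: (continuous_big mc) => p _; apply: (continuous_big mc) => q _.
  by apply: max0c => u; apply: cvgB; exact: fc.
Qed.

End ThresholdWeight.

Lemma sum_fibers (R : realType) (I V : finType) (w : I -> R) (phi : I -> V) :
  \sum_v \sum_(i | phi i == v) w i = \sum_i w i.
Proof. by rewrite [RHS](partition_big phi xpredT). Qed.

Lemma sum_ratio_continuous (R : realType) (T : topologicalType) (I : finType)
    (J : pred I) (w : T -> I -> R) :
  (forall i, continuous (fun t => w t i)) -> (forall t, \sum_i w t i != 0) ->
  continuous (fun t => (\sum_(i | J i) w t i) / \sum_i w t i).
Proof.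
move=> wc w0.
have sc (K : pred I) : continuous (fun t => \sum_(i | K i) w t i).
  by apply: (@continuous_big R _ +%R 0 K) => [|i _]; [exact: add_continuous | exact: wc].
by move=> t; apply: cvgM; [exact: sc | apply: cvgV; [exact: w0 | exact: sc]].
Qed.

(** * Maps between order complexes *)

Section OrderComplex.
Context {R : realType}.
Local Notation coord x := (set_val x : _ -> R).

Lemma order_complexP d (P : finPOrderType d) (s : {set P}) :
  reflect {in s &, forall p q, (p <= q)%O || (q <= p)%O}
          (s \in simplices (order_complex P)).
Proof.
rewrite /order_complex /= inE /is_chain.
apply: (iffP forall_inP) => [cs p q ps qs|cs p ps].
  by have /forall_inP/(_ _ qs) := cs p ps.
by apply/forall_inP => q; apply: cs.
Qed.

(** Two chains with pairwise comparable members unite to one chain, which is the common simplex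
    needed for a straight-line homotopy. *)
Lemma order_contiguous_homotopic d (P : finPOrderType d) (A : topologicalType)
    (f g : A -> realization R (order_complex P)) :
  continuous f -> continuous g ->
  (forall a p q, coord (f a) p != 0 -> coord (g a) q != 0 ->
     (p <= q)%O || (q <= p)%O) ->
  homotopic_line R f g.
Proof.
move=> fc gc fg; apply: contiguous_homotopic_line => // a.
exists (finset (fun v => (coord (f a) v != 0) || (coord (g a) v != 0))); last first.
  by move=> v /orP; rewrite inE.
apply/order_complexP => p q; rewrite !inE => /orP[fp|gp] /orP[fq|gq].
- by have /order_complexP := coord_support (f a); apply; rewrite inE.
- exact: fg fp gq.
- by rewrite orbC; exact: fg fq gp.
- by have /order_complexP := coord_support (g a); apply; rewrite inE.
Qed.

(* A continuous substitute for passing to the barycentric subdivision: [phi]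
   need only be monotone on nonempty chains, and maps built from different
   intervals of levels can be compared through the nesting of their chains. *)
Lemma threshold_map d d' (P : finPOrderType d) (Q : finPOrderType d')
    (a b : R) (phi : {set P} -> Q) :
  0 <= a -> a < b -> b * #|P|%:R < 1 ->
  (forall c c' : {set P}, is_chain c' -> c != finset.set0 -> c \subset c' ->
     (phi c <= phi c')%O) ->
  exists2 F : realization R (order_complex P) -> realization R (order_complex Q),
    continuous F &
    forall x q, coord (F x) q != 0 -> exists c : {set P},
      [/\ threshold_weight a b (coord x) c != 0, is_chain c, c != finset.set0 &
          q = phi c].
Proof.
move=> a0 ab bP mono.
pose w (x : realization R (order_complex P)) := threshold_weight a b (coord x).
(* The normalized weights on subsets of [P] are pushed forward along [phi]. *)
pose F x q := (\sum_(c | phi c == q) w x c) / \sum_c w x c.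
have w0 x c : 0 <= w x c by exact: threshold_weight_ge0.
have W0 x : 0 < \sum_c w x c by exact: threshold_weight_sum_gt0.
have wc x c : w x c != 0 -> is_chain c && (c != finset.set0).
  move=> /threshold_weight_neq0P[c1 c2 _]; apply/andP; split.
    have := coord_support x; rewrite /order_complex /= => xs.
    have := is_chain_sub (t := c) _ xs; rewrite inE; apply.
    by apply/fintype.subsetP => p /c1 ap; rewrite inE gt_eqF // (le_lt_trans a0 ap).
  (* If [c] were empty, every coordinate would be below [b], and their sum at most [b * #|P|], which
     is less than $1$. *)
  apply/negP => /eqP c0; have := coord_sum x; apply/eqP; rewrite lt_eqF //.
  apply: le_lt_trans bP; rewrite -sum1_card natr_sum mulr_sumr.
  by apply: ler_sum => p _; rewrite mulr1 ltW // c2 // c0 inE.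
have Fs x q : F x q != 0 -> exists2 c, w x c != 0 & q = phi c.
  rewrite mulf_eq0 negb_or => /andP[+ _]; apply: contraNP => noc.
  apply/eqP/big1 => c /eqP cq; apply/eqP; apply: contrapT => /negP wc0.
  by apply: noc; exists c.
have FP x : realization R (order_complex Q) (F x).
  split.
  - by move=> q; rewrite divr_ge0 ?sumr_ge0.
  - by rewrite -mulr_suml sum_fibers divff // gt_eqF.
  - apply/order_complexP => p q; rewrite !inE.
    move=> /Fs[c wxc ->] /Fs[c' wxc' ->].
    have /andP[cc c0] := wc _ _ wxc; have /andP[cc' c'0] := wc _ _ wxc'.
    case/orP: (threshold_weight_nested wxc wxc') => cs; apply/orP; [left|right];
      exact: mono cs.
exists (to_realization FP).
  have wcont c : continuous (fun x => w x c).
    by apply: threshold_weight_continuous => v; exact: barycentric_coord_continuous.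
  apply: to_realization_continuous => q.
  by apply: sum_ratio_continuous => // x; rewrite gt_eqF.
move=> x q; rewrite set_valE /= => /Fs[c wxc qE]; exists c.
by have /andP[cc c0] := wc _ _ wxc.
Qed.

End OrderComplex.

(** * Hom complexes of complete graphs *)

Section CoreMap.
Context {R : realType} {H : graph} (Hc : centered_graph H).
Local Notation coord x := (set_val x : _ -> R).
Local Notation hom n := (multihom (complete_graph n) H).
Local Notation space n := (hom_space R (complete_graph n) H).

(** Small enough that both level intervals $[0,t)$ and $[t,2t)$ suit [threshold_map]; the added $1$
    keeps it positive when there are no multihomomorphisms. *)
Definition threshold n : R := (2 * (#|{: hom n}|%:R + 1))^-1.

Lemma threshold_gt0 n : 0 < threshold n.
Proof. by rewrite invr_gt0 mulr_gt0 // ltr_wpDl ?ler0n. Qed.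

Lemma threshold_card n : 2 * threshold n * #|{: hom n}|%:R < 1.
Proof.
rewrite /threshold; set N : R := #|_|%:R; have N0 : 0 <= N by exact: ler0n.
by rewrite invfM mulVKf ?pnatr_eq0// mulrC ltr_pdivrMr ?mul1r; lra.
Qed.

(** A specification by supports: comparing maps up to homotopy only requires comparing the elements
    in their supports. *)
Definition is_core_map n m (e : hom m) (F : space n -> space m) : Prop :=
  continuous F /\ forall x q, coord (F x) q != 0 -> exists s : {set hom n},
    [/\ threshold_weight 0 (threshold n) (coord x) s != 0, is_chain s,
        s != finset.set0 & q = hom_diagonal e (core s)].

Lemma core_map_exists n m (e : hom m) : (1 < n)%N ->
  exists F : space n -> space m, is_core_map e F.
Proof.
move=> n1; have t0 := threshold_gt0 n.
have [||||F Fc Fs] := @threshold_map R _ _ (hom n) (hom m) 0 (threshold n)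
  (fun s => hom_diagonal e (core s)).
- exact: lexx.
- exact: t0.
- apply: le_lt_trans (threshold_card n); apply: ler_wpM2r; first exact: ler0n.
  lra.
- move=> s s' cs' s0 ss'; apply: hom_diagonal_le; last exact: core_clique.
    exact: core_neq0.
  exact: coreS.
by exists F.
Qed.

(** Members of [s] have coordinates above the threshold, non-members of [s'] below it. Thus a map
    using low levels sees larger chains than one using high levels. *)
Lemma high_sub_low n (x : hom n -> R) (s s' : {set hom n}) :
  threshold_weight (threshold n) (2 * threshold n) x s != 0 ->
  threshold_weight 0 (threshold n) x s' != 0 -> s \subset s'.
Proof.
move=> /threshold_weight_neq0P[hs _ _] /threshold_weight_neq0P[_ ls' _].
apply/fintype.subsetP => p /hs hp; apply: contraT => /ls' /(lt_trans hp).
by rewrite ltxx.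
Qed.

(** The homotopies run through [F], [F3], [F2], [F1], [id]. Maps with larger values ([F], [F2]) use
    low levels and those with smaller values ([F3], [F1]) high levels, so that enlarging the chain
    and enlarging the values act in the same direction. *)
Lemma core_map_homotopic_id n (e : hom n) (F : space n -> space n) :
  (1 < n)%N -> is_core_map e F -> homotopic_line R F id.
Proof.
move=> n1 [Fc Fs]; have t0 := threshold_gt0 n.
have tn := threshold_card n.
pose f1 (eta : hom n) (i : 'I_n) := eta i.
pose f3 (eta : hom n) (i : 'I_n) := self_commutant (eta i).
pose f2 (eta : hom n) (i : 'I_n) := f1 eta i :|: f3 eta i.
have f10 eta i : f1 eta i != finset.set0 by exact: multihom_neq0.
have f30 eta i : f3 eta i != finset.set0 by exact: self_commutant_neq0.
have f12 eta i : f1 eta i \subset f2 eta i by exact: finset.subsetUl.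
have f32 eta i : f3 eta i \subset f2 eta i by exact: finset.subsetUr.
have f20 eta i : f2 eta i != finset.set0.
  apply: contraNneq (f10 eta i) => f20.
  by rewrite -finset.subset0 -f20 f12.
have f2CC eta i : f2 eta i \subset commutant (commutant (eta i)).
  by rewrite finset.subUset sub_bicommutant finset.subsetIr.
have f1CC eta i := fintype.subset_trans (f12 eta i) (f2CC eta i).
have f3CC eta i := fintype.subset_trans (f32 eta i) (f2CC eta i).
have [||||F1 F1c F1s] := @threshold_map R _ _ (hom n) (hom n) (threshold n)
  (2 * threshold n) (hom_union e f1); [lra|lra|exact: tn| |].
  by move=> s s' cs' s0 ss'; exact: hom_union_le.
have [||||F3 F3c F3s] := @threshold_map R _ _ (hom n) (hom n) (threshold n)
  (2 * threshold n) (hom_union e f3); [lra|lra|exact: tn| |].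
  by move=> s s' cs' s0 ss'; exact: hom_union_le.
have [||||F2 F2c F2s] := @threshold_map R _ _ (hom n) (hom n) 0
  (threshold n) (hom_union e f2); [lra|lra| | |].
- apply: le_lt_trans tn; apply: ler_wpM2r; first exact: ler0n.
  lra.
- by move=> s s' cs' s0 ss'; exact: hom_union_le.
have F_F3 : homotopic_line R F F3.
  apply: order_contiguous_homotopic => // x p q.
  move=> /Fs[s' [ws' cs' s'0 ->]] /F3s[s [ws cs s0 ->]].
  have ss' := high_sub_low ws ws'; apply/orP; right.
  apply/forallP => i; rewrite hom_unionE // hom_diagonalE ?core_neq0 ?core_clique //.
  apply/bigcupsP => eta es; apply: self_commutant_sub_core.
  exact: (fintype.subsetP ss').
have F3_F2 : homotopic_line R F3 F2.
  apply: order_contiguous_homotopic => // x p q.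
  move=> /F3s[s [ws cs s0 ->]] /F2s[s' [ws' cs' s'0 ->]].
  have ss' := high_sub_low ws ws'; apply/orP; left.
  exact: hom_union_le.
have F2_F1 : homotopic_line R F2 F1.
  apply: order_contiguous_homotopic => // x p q.
  move=> /F2s[s' [ws' cs' s'0 ->]] /F1s[s [ws cs s0 ->]].
  have ss' := high_sub_low ws ws'; apply/orP; right.
  exact: hom_union_le.
have F1_id : homotopic_line R F1 id.
  apply: order_contiguous_homotopic => // [x|x p q]; first exact: cvg_id.
  move=> /F1s[s [/threshold_weight_neq0P[hs _ _] cs s0 ->]] xq.
  have /order_complexP xchain := coord_support x.
  have sle eta : eta \in s -> (eta <= q)%O || (q <= eta)%O.
    by move=> /hs hx; apply: xchain; rewrite inE // gt_eqF //; lra.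
  (* Both [q] and the members of [s] lie in the support of [x]. Either [q] is below some member,
     hence below the union, or all members are below [q], and so is their union. *)
  have [/existsP[eta /andP[es qeta]]|noeta] :=
    boolP [exists eta, (eta \in s) && (q <= eta)%O].
    apply/orP; right; apply/forallP => i; rewrite hom_unionE //.
    apply: fintype.subset_trans (multihom_le_sub i qeta) _.
    exact: (finset.bigcup_sup eta).
  apply/orP; left; apply/forallP => i; rewrite hom_unionE //.
  apply/bigcupsP => eta es; apply: multihom_le_sub.
  case/orP: (sle _ es) => // qeta.
  by case/existsP: noeta; exists eta; rewrite es.
apply: homotopic_line_trans F_F3 _; apply: homotopic_line_trans F3_F2 _.
exact: homotopic_line_trans F2_F1 F1_id.
Qed.

(** The composite is compared with a core map [K] from the space of $\mathrm{Hom}(K_n,H)$ to itself,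
    which is already known to be homotopic to the identity. *)
Lemma core_map_comp n m (e : hom n) (e' : hom m)
    (F : space n -> space m) (G : space m -> space n) :
  (1 < n)%N -> (1 < m)%N -> is_core_map e' F -> is_core_map e G ->
  homotopic_line R (G \o F) id.
Proof.
move=> n1 m1 [Fc Fs] [Gc Gs].
have [K Kcore] := core_map_exists e n1; have [Kc Ks] := Kcore.
apply: homotopic_line_trans (core_map_homotopic_id n1 Kcore).
apply: order_contiguous_homotopic => //.
  by move=> x; apply: continuous_comp; [exact: Fc | exact: Gc].
move=> x p q /Gs[t [/threshold_weight_neq0P[ht _ _] ct t0 ->]].
move=> /Ks[s [ws cs s0 ->]].
(* Each member of [t] lies in the support of [F x], so it is constant with value the core of a
   superlevel chain of [x]. Such a chain is nested with [s], which makes the two cores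
   comparable. *)
have tC : {in t, forall eta : hom m, exists D : {set H},
    [/\ forall i, eta i = D, D \subset commutant D,
        commutant (commutant D) = D & (D \subset core s) || (core s \subset D)]}.
  move=> eta /ht /(gt_eqF) /negbT /Fs[r [wr cr r0 ->]]; exists (core r); split.
  - by move=> i; rewrite hom_diagonalE ?core_neq0 ?core_clique.
  - exact: core_clique.
  - exact: coreK.
  - by case/orP: (threshold_weight_nested wr ws) => /coreS ->; rewrite ?orbT.
case/orP: (core_closed_cliques (coreK s) tC) => le; apply/orP.
  by left; apply: hom_diagonal_le; rewrite ?core_neq0 ?core_clique.
by right; apply: hom_diagonal_le; rewrite ?core_neq0 ?core_clique.
Qed.

End CoreMap.

Lemma hom_space_empty (R : realType) (G H : graph) :
  (multihom G H -> False) -> hom_space R G H -> False.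
Proof.
move=> noeta x; have := coord_sum x; rewrite big1; last by move=> eta; case: (noeta eta).
by move/eqP; rewrite eq_sym oner_eq0.
Qed.

Lemma homotopy_equivalent_empty (R : realType) (A B : topologicalType) :
  (A -> False) -> (B -> False) -> homotopy_equivalent R A B.
Proof.
move=> noA noB.
exists (fun a => False_rect B (noA a)), (fun b => False_rect A (noB b)); split.
- by move=> a; case: (noA a).
- by move=> b; case: (noB b).
- by exists fst; split=> [|a|a]; [move=> -[a]|case: (noA a)|case: (noA a)]; case: (noA a).
- by exists fst; split=> [|a|a]; [move=> -[a]|case: (noB a)|case: (noB a)]; case: (noB a).
Qed.

(** Core maps in the two directions are mutually inverse up to homotopy; [e] and [e'] supply the
    default values of [hom_diagonal]. *)
Lemma hom_space_complete_equivalent (R : realType) (H : graph) (n m : nat) :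
  centered_graph H -> (1 < n)%N -> (1 < m)%N ->
  multihom (complete_graph n) H -> multihom (complete_graph m) H ->
  homotopy_equivalent R (hom_space R (complete_graph n) H)
    (hom_space R (complete_graph m) H).
Proof.
move=> Hc n1 m1 e e'.
have [F coreF] := core_map_exists (R := R) Hc e' n1.
have [G coreG] := core_map_exists (R := R) Hc e m1.
exists F, G; split; [by case: coreF | by case: coreG | |].
  by apply: homotopic_lineW; apply: (core_map_comp Hc n1 m1 coreF coreG).
by apply: homotopic_lineW; apply: (core_map_comp Hc m1 n1 coreG coreF).
Qed.

Lemma constant_multihom (G H : graph) (v : H) :
  edge v v -> is_multihom [ffun _ : G => finset.set1 v].
Proof.
move=> vv; apply/andP; split; apply/forallP => i.
  by rewrite ffunE -cards_eq0 cards1.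
apply/forallP => j; apply/implyP => _; rewrite !ffunE.
by apply/fintype.subsetP => -[x y]; rewrite !inE /= => /andP[/eqP-> /eqP->].
Qed.

Theorem theorem1p3 (R : realType) (n : nat) (hn : (2 <= n)%N)
    (V : finType) (X : simplicial_complex V) :
  homotopy_equivalent R
    (hom_space R (complete_graph n) (subdivision_graph X))
    (hom_space R (complete_graph 2) (subdivision_graph X)).
Proof.
(* A nonempty simplex is a looped vertex and gives the constant multihomomorphisms used as defaults;
   if there is none, both spaces are empty. *)
have [v _|noX] := pickP (xpredT : pred (subdivision_graph X)).
  have vv : edge v v by apply/orP; left.
  apply: hom_space_complete_equivalent => //.
  - exact: subdivision_graph_centered.
  - exact: Multihom (constant_multihom _ vv).
  - exact: Multihom (constant_multihom _ vv).
have no_hom m : (1 < m)%N ->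
    hom_space R (complete_graph m) (subdivision_graph X) -> False.
  move=> m1; apply: hom_space_empty => eta.
  have /set0Pn[v _] := multihom_neq0 eta (Ordinal m1).
  by have := noX v.
by apply: homotopy_equivalent_empty; apply: no_hom.
Qed.
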